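(* Let $X\to Z$ be a discrete memoryless channel (the wiretapper's channel). For block-length $n$, let $C_1,\dots,C_M$ be codes of block-length $n$ over the input alphabet of this channel, with $|C_u|=L$ for every $u\in\{1,2,\dots,M\}$. Let the message $\mathbf{U}$ be uniformly distributed on $\{1,\dots,M\}$; given $\mathbf{U}=u$, let the transmitted word $\mathbf{X}$ be chosen uniformly at random from $C_u$; and let $\mathbf{Z}$ be the output of $n$ uses of the channel $X\to Z$ with input $\mathbf{X}$. If each code $C_u$, $u\in\{1,2,\dots,M\}$, comes from a sequence of codes that approach capacity asymptotically over the channel $X\to Z$, then $$\frac{I(\mathbf{U};\mathbf{Z})}{n}\to 0\quad\text{as } n\to\infty .$$
   Context: The channel has finite input and output alphabets. A code of block-length $n$ is a set of length-$n$ words over the input alphabet; $M$ and $L$ may depend on $n$. $I(\cdot\,;\cdot)$ denotes mutual information. A sequence of codes of increasing block-length $n$ is said to approach capacity asymptotically over a channel in the usual sense: the rates of the codes tend to the channel capacity while the probability of decoding error over the channel tends to $0$ as $n\to\infty$. Since $\mathbf{Z}$ depends on $\mathbf{U}$ only through $\mathbf{X}$, $\mathbf{U}\to\mathbf{X}\to\mathbf{Z}$ is a Markov chain. *)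

(* Defs.v *)
From HB Require Import structures.
From mathcomp Require Import all_boot all_order all_algebra.
From mathcomp Require Import all_classical all_reals all_analysis.
Set Implicit Arguments.
Unset Strict Implicit.
Unset Printing Implicit Defensive.
Import Order.TTheory GRing.Theory Num.Theory.
Import numFieldNormedType.Exports.
Local Open Scope classical_set_scope.
Local Open Scope ring_scope.

Definition is_pmf (R : realType) (T : finType) (p : T -> R) : Prop :=
  (forall t, 0 <= p t) /\ \sum_t p t = 1.

Definition log2 (R : realType) (x : R) : R := ln x / ln 2.

Section random_variables.
Variables (R : realType) (Omega : finType) (P : Omega -> R).

Definition law (S : finType) (X : Omega -> S) (s : S) : R :=
  \sum_(w | X w == s) P w.

(* I(X;Y) in bits. The convention 0 log 0 = 0 is automatic; when P is a pmf a
   marginal in the denominator vanishes only together with the joint mass. *)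
Definition mutual_info (S T : finType) (X : Omega -> S) (Y : Omega -> T) : R :=
  \sum_s \sum_t
    law (fun w => (X w, Y w)) (s, t) *
    log2 (law (fun w => (X w, Y w)) (s, t) / (law X s * law Y t)).

End random_variables.

Definition word (A : finType) (n : nat) : finType := {ffun 'I_n -> A}.

Section channels.
Variables (R : realType) (A B : finType).
Implicit Type W : A -> B -> R.

(* W a b is the probability of output b given input a. *)
Definition is_channel W : Prop := forall a, is_pmf (W a).

Definition dmc W (n : nat) (x : word A n) (z : word B n) : R :=
  \prod_(i < n) W (x i) (z i).

Definition capacity W : R :=
  sup [set mutual_info (fun ab : A * B => p ab.1 * W ab.1 ab.2) fst snd
      | p in [set p : A -> R | is_pmf p]].

Definition rate (n : nat) (C : {set word A n}) : R := log2 #|C|%:R / n%:R.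

(* Probability that the decoder g errs when a uniformly chosen codeword of C
   is sent (average error probability). *)
Definition error_prob W (n : nat) (C : {set word A n})
    (g : word B n -> word A n) : R :=
  \sum_(x in C) #|C|%:R^-1 * \sum_(z | g z != x) dmc W x z.

Definition approaches_capacity W (N : nat -> nat)
    (C : forall k, {set word A (N k)}) : Prop :=
  (rate (C k) @[k --> \oo] --> capacity W) /\
  exists g : forall k, word B (N k) -> word A (N k),
    error_prob W (C k) (g k) @[k --> \oo] --> (0 : R).

(* Joint law of (U, X, Z): U is uniform on the M messages, X is uniform on
   C U given U, and Z is the channel output for the input X; in particular
   U -> X -> Z is a Markov chain. *)
Definition wiretap_law W (n M : nat) (C : 'I_M -> {set word A n})
    (w : 'I_M * word A n * word B n) : R :=
  let: (u, x, z) := w in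
  M%:R^-1 * ((x \in C u)%:R / #|C u|%:R) * dmc W x z.

Definition message_rv (n M : nat) (w : 'I_M * word A n * word B n) : 'I_M :=
  w.1.1.

Definition output_rv (n M : nat) (w : 'I_M * word A n * word B n) : word B n :=
  w.2.

Lemma dmc_pmf W n (x : word A n) : is_channel W -> is_pmf (dmc W x).
Proof.
move=> hW; split=> [z|]; first by apply: prodr_ge0 => i _; case: (hW (x i)).
rewrite /dmc -(bigA_distr_bigA (fun i b => W (x i) b)).
by apply: big1 => i _; case: (hW (x i)).
Qed.

Lemma wiretap_law_pmf W n M L (C : 'I_M -> {set word A n}) :
  is_channel W -> (0 < M)%N -> (0 < L)%N -> (forall u, #|C u| = L) ->
  is_pmf (wiretap_law W C).
Proof.
move=> hW M0 L0 hC; split=> [[[u x] z]|].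
  rewrite /wiretap_law !mulr_ge0 ?invr_ge0 ?ler0n //.
  by case: (dmc_pmf x hW).
have M_neq0 : M%:R != 0 :> R by rewrite pnatr_eq0 -lt0n.
have L_neq0 : L%:R != 0 :> R by rewrite pnatr_eq0 -lt0n.
transitivity (\sum_u \sum_x \sum_z wiretap_law W C (u, x, z)).
  rewrite pair_bigA pair_bigA /=.
  by apply: eq_bigr => -[[]].
transitivity (\sum_(u < M) M%:R^-1 : R); last first.
  by rewrite sumr_const card_ord -[LHS]mulr_natl mulfV.
apply: eq_bigr => u _.
transitivity (\sum_(x in C u) M%:R^-1 * L%:R^-1 : R); last first.
  by rewrite sumr_const hC -[LHS]mulr_natr mulfVK.
rewrite [RHS]big_mkcond; apply: eq_bigr => x _ /=.
rewrite -mulr_sumr hC; case: (dmc_pmf x hW) => _ ->; rewrite mulr1.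
by case: (x \in C u); rewrite ?mul1r ?mul0r ?mulr0.
Qed.

End channels.

(* Main.v *)
Require Import Defs.
From HB Require Import structures.
From mathcomp Require Import all_boot all_order all_algebra.
From mathcomp Require Import all_classical all_reals all_analysis.
From mathcomp Require Import ring lra.
Set Implicit Arguments.
Unset Strict Implicit.
Unset Printing Implicit Defensive.
Import Order.TTheory GRing.Theory Num.Theory.
Import numFieldNormedType.Exports.
Local Open Scope classical_set_scope.
Local Open Scope ring_scope.

(* Since U -> X -> Z is a Markov chain, I(U;Z) = I(X;Z) - I(X;Z|U).  By the
   memoryless property I(X;Z) <= n C, where C is the capacity.  Given U = u the
   input is uniform on C_u, so Fano's inequality gives
   I(X;Z|U) >= (1 - e) log2 L - 1, where e bounds the decoding error over all
   u.  Hence 0 <= I(U;Z)/n <= C + 1/n - (1 - e) (log2 L)/n, which tends to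
   C - C = 0.  The bound e is made uniform in u by applying the hypothesis to
   the worst code of each block-length, all codes using their best decoders. *)

(** * Gibbs' inequality and laws of random variables on finite spaces *)

(** Termwise this is [ln x <= x - 1] at [x = q t / p t], multiplied by [p t]. Keeping both total
    masses on the left avoids normalising [p] and [q]. *)
Lemma gibbs (R : realType) (T : finType) (p q : T -> R) :
  (forall t, 0 <= p t) -> (forall t, 0 <= q t) ->
  (forall t, 0 < p t -> 0 < q t) ->
  \sum_t p t - \sum_t q t <= \sum_t p t * ln (p t / q t).
Proof.
move=> p0 q0 pq; rewrite -sumrB; apply: ler_sum => t _.
have [pt0|pt0] := ltP 0 (p t); last first.
  have -> : p t = 0 by apply: le_anti; rewrite pt0 p0.
  by rewrite mul0r sub0r oppr_le0.
have qt0 := pq t pt0.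
have : ln (q t / p t) <= q t / p t - 1.
  rewrite -{1}(subrKC 1 (q t / p t)); apply: le_ln1Dx.
  by rewrite ltrBrDl subrr divr_gt0.
rewrite -[q t / p t]invf_div lnV ?posrE ?divr_gt0 // invf_div.
rewrite -(ler_pM2l pt0) mulrN mulrBr mulr1 mulrCA divff ?gt_eqF // mulr1.
by rewrite lerNl opprB.
Qed.

Lemma law_ge0 (R : realType) (Omega S : finType) (P : Omega -> R)
    (X : Omega -> S) (s : S) :
  (forall w, 0 <= P w) -> 0 <= law P X s.
Proof. by move=> P0; apply: sumr_ge0. Qed.

Lemma expect_law (R : realType) (Omega S : finType) (P : Omega -> R)
    (X : Omega -> S) (f : S -> R) :
  \sum_w P w * f (X w) = \sum_s law P X s * f s.
Proof.
rewrite (partition_big X predT) //=; apply: eq_bigr => s _.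
by rewrite mulr_suml; apply: eq_bigr => w /eqP ->.
Qed.

Lemma law_pmf (R : realType) (Omega S : finType) (P : Omega -> R)
    (X : Omega -> S) : is_pmf P -> is_pmf (law P X).
Proof.
move=> [P0 P1]; split=> [s|]; first exact: law_ge0.
rewrite -P1 -[LHS](eq_bigr _ (fun s _ => mulr1 _)).
by rewrite -(expect_law P X (fun=> 1)); apply: eq_bigr => w _; rewrite mulr1.
Qed.

Lemma law_comp (R : realType) (Omega S T : finType) (P : Omega -> R)
    (X : Omega -> S) (f : S -> T) (t : T) :
  law P (fun w => f (X w)) t = law (law P X) f t.
Proof.
rewrite /law (partition_big X (fun s => f s == t)) //=.
apply: eq_bigr => s /eqP <-; apply: eq_bigl => w.
by case: (X w =P s) => [->|]; rewrite ?eqxx // andbF.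
Qed.

Lemma law_gt0 (R : realType) (Omega S : finType) (P : Omega -> R)
    (X : Omega -> S) (w : Omega) :
  (forall w, 0 <= P w) -> 0 < P w -> 0 < law P X (X w).
Proof.
move=> P0 Pw; rewrite /law (bigD1 w) //=.
by rewrite ltr_wpDr // sumr_ge0.
Qed.

(** The fibre of [X] over [s] lies in the fibre of [f] composed with [X] over [f s]. This makes
    marginals positive wherever the joint law is. *)
Lemma law_comp_ge (R : realType) (Omega S T : finType) (P : Omega -> R)
    (X : Omega -> S) (f : S -> T) (s : S) :
  (forall w, 0 <= P w) -> law P X s <= law P (fun w => f (X w)) (f s).
Proof.
move=> P0; rewrite (law_comp P X f).
have : forall s', 0 <= law P X s' by move=> s'; apply: law_ge0.
by move: (law P X) => Q Q0; rewrite /law (bigD1 s) //= lerDl sumr_ge0.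
Qed.

(** * Mutual information and capacity *)

(** As an expectation of a log density over sample points, mutual information can be manipulated by
    pointwise identities on the support of [P]. *)
Lemma mutual_infoE (R : realType) (Omega S T : finType) (P : Omega -> R)
    (X : Omega -> S) (Y : Omega -> T) :
  mutual_info P X Y =
  (\sum_w P w * ln (law P (fun w => (X w, Y w)) (X w, Y w) /
                    (law P X (X w) * law P Y (Y w)))) / ln 2.
Proof.
rewrite (expect_law P (fun w => (X w, Y w)) (fun st =>
  ln (law P (fun w => (X w, Y w)) st / (law P X st.1 * law P Y st.2)))).
rewrite mulr_suml /mutual_info pair_bigA /=.
by apply: eq_bigr => -[s t] _ /=; rewrite /log2 mulrA.
Qed.

(** Brings arbitrary variables to the form with two projections in which [capacity] is defined. *)
Lemma mutual_info_joint_law (R : realType) (Omega S T : finType)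
    (P : Omega -> R) (X : Omega -> S) (Y : Omega -> T) :
  mutual_info P X Y = mutual_info (law P (fun w => (X w, Y w))) fst snd.
Proof.
have id_law (Q : S * T -> R) st : law Q (fun w => (w.1, w.2)) st = Q st.
  by rewrite /law (eq_bigl (pred1 st)) ?big_pred1_eq // => -[].
apply: eq_bigr => s _; apply: eq_bigr => t _.
by rewrite id_law -!law_comp.
Qed.

Lemma ln2_gt0 (R : realType) : 0 < ln (2 : R).
Proof. by rewrite ln_gt0 // ltr1n. Qed.

Lemma mutual_info_ge0 (R : realType) (Omega S T : finType) (P : Omega -> R)
    (X : Omega -> S) (Y : Omega -> T) :
  is_pmf P -> 0 <= mutual_info P X Y.
Proof.
move=> hP; have [P0 _] := hP; pose XY w := (X w, Y w).
rewrite mutual_infoE divr_ge0 ?(ltW (ln2_gt0 R)) //.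
rewrite (expect_law P XY (fun st =>
  ln (law P XY st / (law P X st.1 * law P Y st.2)))).
apply: le_trans (gibbs (p := law P XY)
  (q := fun st => law P X st.1 * law P Y st.2) _ _ _) => [||st|[s t] st0].
- rewrite -(pair_bigA _ (fun s t => law P X s * law P Y t)) /=.
  rewrite (law_pmf XY hP).2.
  under eq_bigr do rewrite -mulr_sumr (law_pmf Y hP).2 mulr1.
  by rewrite (law_pmf X hP).2 subrr.
- by move=> st; apply: law_ge0.
- by rewrite mulr_ge0 ?law_ge0.
- rewrite mulr_gt0 //.
    exact: lt_le_trans st0 (law_comp_ge XY fst (s, t) P0).
  exact: lt_le_trans st0 (law_comp_ge XY snd (s, t) P0).
Qed.

(** A crude bound that makes the set defining [capacity] bounded. The joint law is at most the law
    of [X], so the log density is at most [ln (1 / law P Y y)], hence at most [1 / law P Y y]; the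
    expectation of the latter counts the values of positive probability. *)
Lemma mutual_info_ub (R : realType) (Omega S T : finType) (P : Omega -> R)
    (X : Omega -> S) (Y : Omega -> T) :
  is_pmf P -> mutual_info P X Y <= #|T|%:R / ln 2.
Proof.
move=> hP; have [P0 _] := hP; pose XY w := (X w, Y w).
rewrite mutual_infoE ler_pM2r ?invr_gt0 ?ln2_gt0 //.
apply: (@le_trans _ _ (\sum_w P w * (law P Y (Y w))^-1)); last first.
  rewrite (expect_law P Y (fun t => (law P Y t)^-1)) -sum1_card natr_sum.
  apply: ler_sum => t _.
  by have [->|?] := eqVneq (law P Y t) 0; rewrite ?mul0r ?divff.
apply: ler_sum => w _.
have [Pw|Pw] := ltP 0 (P w); last first.
  have -> : P w = 0 by apply: le_anti; rewrite Pw P0.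
  by rewrite !mul0r.
rewrite ler_pM2l //.
have jXY : law P XY (X w, Y w) <= law P X (X w).
  exact: (law_comp_ge XY fst (X w, Y w) P0).
have X0 := law_gt0 X P0 Pw; have Y0 := law_gt0 Y P0 Pw.
have XY0 : 0 < law P XY (X w, Y w) := law_gt0 XY P0 Pw.
apply: (@le_trans _ _ (ln (law P Y (Y w))^-1)).
  rewrite ler_ln ?posrE ?invr_gt0 ?divr_gt0 ?mulr_gt0 //.
  rewrite invfM mulrA ler_piMl ?invr_ge0 ?(ltW Y0) //.
  by rewrite ler_pdivrMr ?mul1r.
apply: le_trans (_ : _ <= (law P Y (Y w))^-1 - 1) _; last first.
  by rewrite gerBl.
rewrite -{1}(subrKC 1 (law P Y (Y w))^-1); apply: le_ln1Dx.
by rewrite ltrBrDl subrr invr_gt0.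
Qed.

Lemma mutual_info_le_capacity (R : realType) (A B Omega : finType)
    (W : A -> B -> R) (P : Omega -> R) (X : Omega -> A) (Y : Omega -> B) :
  is_channel W -> is_pmf P ->
  (forall a b, law P (fun w => (X w, Y w)) (a, b) = law P X a * W a b) ->
  mutual_info P X Y <= capacity W.
Proof.
move=> hW hP hXY; apply: ub_le_sup.
  (* [sup] is an upper bound only for a set that is bounded above. *)
  exists (#|B|%:R / ln 2) => _ [p [p0 p1] <-]; apply: mutual_info_ub.
  split=> [[a b]|]; first by rewrite mulr_ge0 ?(hW a).1.
  rewrite -(pair_bigA _ (fun a b => p a * W a b)) /= -p1.
  by apply: eq_bigr => a _; rewrite -mulr_sumr (hW a).2 mulr1.
exists (law P X); first exact: law_pmf.
rewrite [RHS]mutual_info_joint_law.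
by congr (mutual_info _ fst snd); apply/funext => -[a b] /=; rewrite hXY.
Qed.

(** * Memoryless channels: the bound I(X;Z) <= n C *)

Lemma dmc_marginal (R : realType) (A B : finType) (W : A -> B -> R) n
    (x : word A n) (i : 'I_n) (b : B) :
  is_channel W -> \sum_(z : word B n | z i == b) dmc W x z = W (x i) b.
Proof.
move=> hW.
(* The event [z i == b] becomes a product over all coordinates, with factor 1 at each [j != i], so
   that the sum over words factors. *)
transitivity (\prod_j \sum_c (W (x j) c * ((j == i) ==> (c == b))%:R)).
  rewrite bigA_distr_bigA /= big_mkcond /=; apply: eq_bigr => z _.
  rewrite big_split /= -/(dmc W x z) (bigD1 i) //= eqxx /=.
  rewrite big1 ?mulr1 => [|j /negPf -> //].
  by case: eqP => _; rewrite ?mulr1 ?mulr0.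
rewrite (bigD1 i) //= (bigD1 b) //= !eqxx mulr1 [X in _ + X]big1 ?addr0; last first.
  by move=> c /negPf ->; rewrite mulr0.
rewrite big1 ?mulr1 // => j /negPf -> /=.
by under eq_bigr do rewrite mulr1; rewrite (hW _).2.
Qed.

Lemma law_coord_channel (R : realType) (A B Omega : finType)
    (W : A -> B -> R) n (P : Omega -> R)
    (X : Omega -> word A n) (Z : Omega -> word B n) (i : 'I_n) (a : A) (b : B) :
  is_channel W ->
  (forall x z, law P (fun w => (X w, Z w)) (x, z) = law P X x * dmc W x z) ->
  law P (fun w => (X w i, Z w i)) (a, b) = law P (fun w => X w i) a * W a b.
Proof.
move=> hW hXZ.
rewrite (law_comp P (fun w => (X w, Z w)) (fun xz => (xz.1 i, xz.2 i))).
rewrite (law_comp P X (fun x : word A n => x i)) /law -/(law P _).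
transitivity (\sum_(x : word A n | x i == a) \sum_(z : word B n | z i == b)
    law P (fun w => (X w, Z w)) (x, z)).
  by rewrite pair_big /=; apply: eq_big => -[].
rewrite mulr_suml; apply: eq_bigr => x /eqP <-.
by under eq_bigr do rewrite hXZ; rewrite -mulr_sumr dmc_marginal.
Qed.

Lemma ln_div (R : realType) (x y : R) :
  0 < x -> 0 < y -> ln (x / y) = ln x - ln y.
Proof. by move=> x0 y0; rewrite lnM ?posrE ?invr_gt0 // lnV ?posrE. Qed.

Lemma ln_prod (R : realType) (I : finType) (F : I -> R) :
  (forall i, 0 < F i) -> ln (\prod_i F i) = \sum_i ln (F i).
Proof.
move=> F0; suff [] : 0 < \prod_i F i /\ ln (\prod_i F i) = \sum_i ln (F i) by [].
elim/big_ind2: _ => [|x a y b [x0 <-] [y0 <-]|i _]; rewrite ?ln1 ?ltr01 //.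
by rewrite mulr_gt0 // lnM ?posrE.
Qed.

(** The arguments of [ln] are known to be positive only where [P w] is; elsewhere the weight 0
    removes the term. *)
Lemma eq_expect (R : realType) (Omega : finType) (P f g : Omega -> R) :
  (forall w, 0 <= P w) -> (forall w, 0 < P w -> f w = g w) ->
  \sum_w P w * f w = \sum_w P w * g w.
Proof.
move=> P0 fg; apply: eq_bigr => w _.
have [/fg ->//|Pw] := ltP 0 (P w).
by have -> : P w = 0 by [apply: le_anti; rewrite Pw P0]; rewrite !mul0r.
Qed.

Lemma le_expect (R : realType) (Omega : finType) (P f g : Omega -> R) :
  (forall w, 0 <= P w) -> (forall w, 0 < P w -> f w <= g w) ->
  \sum_w P w * f w <= \sum_w P w * g w.
Proof.
move=> P0 fg; apply: ler_sum => w _.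
have [Pw|Pw] := ltP 0 (P w); first by rewrite ler_pM2l // fg.
by have -> : P w = 0 by [apply: le_anti; rewrite Pw P0]; rewrite !mul0r.
Qed.

(** I(X;Z) is at most the sum of the I(X_i;Z_i), even for dependent input letters, and each
    coordinate pair is a single use of [W]. *)
Lemma mutual_info_dmc_le (R : realType) (A B Omega : finType)
    (W : A -> B -> R) n (P : Omega -> R)
    (X : Omega -> word A n) (Z : Omega -> word B n) :
  is_channel W -> is_pmf P ->
  (forall x z, law P (fun w => (X w, Z w)) (x, z) = law P X x * dmc W x z) ->
  mutual_info P X Z <= n%:R * capacity W.
Proof.
move=> hW hP hXZ; have [P0 _] := hP.
pose Xi (i : 'I_n) w := X w i; pose Zi (i : 'I_n) w := Z w i.
have hi i a b := law_coord_channel i a b hW hXZ.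
apply: (@le_trans _ _ (\sum_(i < n) mutual_info P (Xi i) (Zi i))); last first.
  rewrite -[n in n%:R]card_ord -sum1_card natr_sum mulr_suml.
  by apply: ler_sum => i _; rewrite mul1r; apply: mutual_info_le_capacity => // a b; apply: hi.
under eq_bigr do rewrite mutual_infoE.
rewrite -mulr_suml mutual_infoE ler_pM2r ?invr_gt0 ?ln2_gt0 //.
rewrite exchange_big /=; under [leRHS]eq_bigr do rewrite -mulr_sumr.
rewrite -subr_ge0 -sumrB.
(* The difference of the two sides is the divergence of the law of Z from the
   product of its coordinate laws. *)
have key w : 0 < P w ->
  \sum_(i < n) ln (law P (fun w => (Xi i w, Zi i w)) (Xi i w, Zi i w) /
                   (law P (Xi i) (Xi i w) * law P (Zi i) (Zi i w))) -
  ln (law P (fun w => (X w, Z w)) (X w, Z w) / (law P X (X w) * law P Z (Z w)))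
  = ln (law P Z (Z w) / \prod_(i < n) law P (Zi i) (Z w i)).
  move=> Pw.
  have x0 := law_gt0 X P0 Pw; have z0 := law_gt0 Z P0 Pw.
  have xi0 i := law_gt0 (Xi i) P0 Pw; have zi0 i := law_gt0 (Zi i) P0 Pw.
  have W0 i : 0 < W (Xi i w) (Zi i w).
    have := law_gt0 (fun w => (Xi i w, Zi i w)) P0 Pw.
    by rewrite /= hi pmulr_rgt0 //; exact: xi0.
  have dmc0 : 0 < dmc W (X w) (Z w) by apply: prodr_gt0 => i _; apply: W0.
  have pi0 : 0 < \prod_(i < n) law P (Zi i) (Z w i).
    by apply: prodr_gt0 => i _; apply: zi0.
  (* Input marginals cancel in every density, and the logarithm of [dmc] is the sum of the
     letterwise logarithms of [W], so only output laws survive. *)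
  rewrite hXZ -mulf_div divff ?gt_eqF // mul1r !ln_div //.
  rewrite /dmc (ln_prod W0) (ln_prod zi0).
  have -> : \sum_(i < n) ln (law P (fun w => (Xi i w, Zi i w)) (Xi i w, Zi i w) /
      (law P (Xi i) (Xi i w) * law P (Zi i) (Zi i w))) =
      \sum_i ln (W (Xi i w) (Zi i w)) - \sum_i ln (law P (Zi i) (Zi i w)).
    rewrite -sumrB; apply: eq_bigr => i _.
    by rewrite hi -mulf_div divff ?(gt_eqF (xi0 i)) // mul1r ln_div.
  lra.
under eq_bigr do rewrite -mulrBr.
rewrite (eq_expect P0 key).
rewrite (expect_law P Z (fun z =>
  ln (law P Z z / \prod_(i < n) law P (Zi i) (z i)))).
(* Both laws have mass 1, the product law by distributivity; it is positive on the support of Z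
   because each coordinate law dominates the law of Z. *)
apply: le_trans (gibbs _ _ _) => [|z|z|z z0].
- rewrite -(bigA_distr_bigA (fun i b => law P (Zi i) b)) /= (law_pmf Z hP).2.
  by rewrite big1 ?subrr // => i _; rewrite (law_pmf (Zi i) hP).2.
- exact: law_ge0.
- by apply: prodr_ge0 => i _; apply: law_ge0.
- apply: prodr_gt0 => i _; apply: lt_le_trans z0 _.
  exact: (law_comp_ge Z (fun z : word B n => z i) z P0).
Qed.

(** * The wiretap law, Fano's inequality and the bound at fixed block-length *)

Lemma wiretap_message_law (R : realType) (A B : finType) (W : A -> B -> R)
    n M L (C : 'I_M -> {set word A n}) (u : 'I_M) :
  is_channel W -> (0 < L)%N -> (forall u, #|C u| = L) ->
  law (wiretap_law W C) (@message_rv A B n M) u = M%:R^-1.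
Proof.
move=> hW L0 hC.
transitivity (\sum_(v | v == u) \sum_x \sum_z wiretap_law W C (v, x, z)).
  rewrite /law [LHS]big_mkcond [RHS]big_mkcond /=.
  transitivity (\sum_v \sum_x \sum_z
      if v == u then wiretap_law W C (v, x, z) else 0).
    by rewrite !pair_bigA /=; apply: eq_bigr => -[[]].
  apply: eq_bigr => v _; case: (v == u) => //.
  by rewrite big1 // => x _; rewrite big1.
rewrite big_pred1_eq.
transitivity (\sum_(x in C u) M%:R^-1 * L%:R^-1 : R); last first.
  by rewrite sumr_const hC -[LHS]mulr_natr mulfVK // pnatr_eq0 -lt0n.
rewrite [RHS]big_mkcond; apply: eq_bigr => x _ /=.
rewrite -mulr_sumr hC (dmc_pmf x hW).2 mulr1.
by case: (x \in C u); rewrite ?mul1r ?mul0r ?mulr0.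
Qed.

(** This is the Markov property: the message affects only the weight of [x], so the factor
    [dmc W x z] leaves the sum over messages. *)
Lemma wiretap_input_output_law (R : realType) (A B : finType)
    (W : A -> B -> R) n M (C : 'I_M -> {set word A n}) x z :
  is_channel W ->
  law (wiretap_law W C) (fun w => (w.1.2, w.2)) (x, z) =
  law (wiretap_law W C) (fun w => w.1.2) x * dmc W x z.
Proof.
move=> hW.
have -> : law (wiretap_law W C) (fun w => (w.1.2, w.2)) (x, z) =
    \sum_u wiretap_law W C (u, x, z).
  transitivity (\sum_(w | w == (w.1.1, x, z)) wiretap_law W C w).
    by apply: eq_bigl => -[[u x'] z']; rewrite !xpair_eqE eqxx.
  rewrite (reindex_onto (fun u : 'I_M => (u, x, z)) (fun w => w.1.1)) /=.
    by apply: eq_bigl => u; rewrite !eqxx.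
  by move=> w /eqP.
have -> : law (wiretap_law W C) (fun w => w.1.2) x =
    \sum_u M%:R^-1 * ((x \in C u)%:R / #|C u|%:R).
  transitivity (\sum_u \sum_z wiretap_law W C (u, x, z)).
    rewrite pair_bigA /=.
    transitivity (\sum_(w | w == (w.1.1, x, w.2)) wiretap_law W C w).
      by apply: eq_bigl => -[[u x'] z']; rewrite !xpair_eqE !eqxx andbT.
    rewrite (reindex_onto (fun uz : 'I_M * word B n => (uz.1, x, uz.2))
      (fun w => (w.1.1, w.2))) /=.
      by apply: eq_bigl => -[u z']; rewrite !eqxx.
    by move=> w /eqP.
  by apply: eq_bigr => u _; rewrite /= -mulr_sumr (dmc_pmf x hW).2 mulr1.
by rewrite mulr_suml.
Qed.

(** The decoder may depend on the message, because I(X;Z|U) is conditioned on U. *)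
Lemma wiretap_decoding_error (R : realType) (A B : finType)
    (W : A -> B -> R) n M (C : 'I_M -> {set word A n})
    (g : 'I_M -> word B n -> word A n) :
  \sum_w wiretap_law W C w * (w.1.2 != g w.1.1 w.2)%:R =
  M%:R^-1 * \sum_u error_prob W (C u) (g u).
Proof.
transitivity (\sum_u \sum_x \sum_z
    wiretap_law W C (u, x, z) * (x != g u z)%:R).
  by rewrite !pair_bigA /=; apply: eq_bigr => -[[]].
rewrite mulr_sumr; apply: eq_bigr => u _.
rewrite /error_prob mulr_sumr [RHS]big_mkcond; apply: eq_bigr => x _ /=.
case: (x \in C u); last by rewrite big1 // => z _; rewrite !(mul0r, mulr0).
rewrite !mulr_sumr [RHS]big_mkcond; apply: eq_bigr => z _ /=.
by rewrite eq_sym; case: (_ != _); rewrite ?mulr0 // mul1r mulr1 mulrA.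
Qed.

(* The right-hand side is - H(X|U,Z), in nats. *)
Lemma wiretap_equivocation_ge (R : realType) (A B : finType)
    (W : A -> B -> R) n M L (C : 'I_M -> {set word A n})
    (g : 'I_M -> word B n -> word A n) :
  is_channel W -> (0 < M)%N -> (0 < L)%N -> (forall u, #|C u| = L) ->
  - ln 2 - M%:R^-1 * (\sum_u error_prob W (C u) (g u)) * ln L%:R <=
  \sum_w wiretap_law W C w *
    ln (wiretap_law W C w /
        law (wiretap_law W C) (fun w => (w.1.1, w.2)) (w.1.1, w.2)).
Proof.
move=> hW M0 L0 hC.
set P := wiretap_law W C; pose UZ (w : 'I_M * word A n * word B n) := (w.1.1, w.2).
have hP : is_pmf P := wiretap_law_pmf hW M0 L0 hC.
have [P0 P1] := hP.
have L_gt0 : 0 < L%:R :> R by rewrite ltr0n.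
(* Fano's inequality is Gibbs' inequality for this guess Q(x|u,z) at the
   posterior of x: the decoded word with probability 1/2, otherwise uniform on
   the code. *)
pose Q (w : 'I_M * word A n * word B n) : R :=
  2^-1 * ((w.1.2 == g w.1.1 w.2)%:R + (w.1.2 \in C w.1.1)%:R / L%:R).
have Q0 w : 0 <= Q w by rewrite mulr_ge0 ?invr_ge0 ?addr_ge0 ?divr_ge0 ?ler0n.
have PC w : 0 < P w -> w.1.2 \in C w.1.1.
  case: w => -[u x] z; rewrite /P /=; case: (x \in C u) => //.
  by rewrite !(mul0r, mulr0) ltxx.
have Qgt0 w : 0 < P w -> 0 < Q w.
  by move=> /PC xC; rewrite /Q xC mulr_gt0 ?invr_gt0 // ltr_wpDl // mul1r invr_gt0.
have sumQ u z : \sum_x Q (u, x, z) = 1.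
  rewrite /Q /= -mulr_sumr big_split /= (bigD1 (g u z)) //= eqxx big1 ?addr0; last first.
    by move=> x /negPf ->.
  have sumC : \sum_x (x \in C u)%:R = L%:R :> R.
    rewrite -(hC u) -sum1_card natr_sum [RHS]big_mkcond.
    by apply: eq_bigr => x _; case: (x \in C u).
  by rewrite -mulr_suml sumC divff ?gt_eqF // mulVf ?pnatr_eq0.
(* Gibbs' inequality compares the true law with the law of (U,Z) followed by the guess [Q]; both
   have mass 1. *)
have gib : 0 <= \sum_w P w * ln (P w / (law P UZ (UZ w) * Q w)).
  apply: le_trans (gibbs P0 (q := fun w => law P UZ (UZ w) * Q w) _ _) => [|w|w Pw].
  - rewrite P1 subr_ge0.
    have -> : \sum_w law P UZ (UZ w) * Q w =
        \sum_u \sum_x \sum_z law P UZ (u, z) * Q (u, x, z).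
      by rewrite !pair_bigA /=; apply: eq_bigr => -[[]].
    under eq_bigr do rewrite exchange_big /=.
    under eq_bigr do under eq_bigr do rewrite -mulr_sumr sumQ mulr1.
    rewrite pair_bigA /= -(law_pmf UZ hP).2 le_eqVlt; apply/orP; left.
    by apply/eqP; apply: eq_bigr => -[].
  - by rewrite mulr_ge0 // law_ge0.
  - by rewrite mulr_gt0 ?Qgt0 // law_gt0.
(* On the support the input is a codeword, so [Q w] is at least 1/2 after correct decoding and
   equals 1/(2L) otherwise. *)
have lb : - ln 2 - M%:R^-1 * (\sum_u error_prob W (C u) (g u)) * ln L%:R <=
    \sum_w P w * ln (Q w).
  rewrite -wiretap_decoding_error -/P.
  have -> : ln 2 = \sum_w P w * ln 2 by rewrite -mulr_suml P1 mul1r.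
  rewrite mulr_suml -sumrN -sumrB.
  under eq_bigr do rewrite -mulrN -mulrA -mulrBr.
  apply: le_expect => // w Pw; rewrite /Q (PC _ Pw) mul1r.
  rewrite lnM ?posrE ?invr_gt0 // ?ltr_wpDl ?invr_gt0 // lnV ?posrE //.
  rewrite lerD2l; case: eqP => _ /=.
    by rewrite mul0r oppr0 ln_ge0 // lerDl invr_ge0 ltW.
  by rewrite mul1r add0r lnV ?posrE.
apply: le_trans lb _; rewrite -subr_ge0 -sumrB.
under eq_bigr do rewrite -mulrBr.
apply: le_trans gib _; apply: le_expect => // w Pw.
have uz0 : 0 < law P UZ (UZ w) := law_gt0 UZ P0 Pw.
rewrite -/(UZ w) (ln_div Pw (mulr_gt0 uz0 (Qgt0 w Pw))) (ln_div Pw uz0).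
by rewrite (lnM uz0 (Qgt0 w Pw)) opprD addrA.
Qed.

Lemma wiretap_info_le (R : realType) (A B : finType)
    (W : A -> B -> R) n M L (C : 'I_M -> {set word A n})
    (g : 'I_M -> word B n -> word A n) (e : R) :
  is_channel W -> (0 < M)%N -> (0 < L)%N -> (forall u, #|C u| = L) ->
  (forall u, error_prob W (C u) (g u) <= e) ->
  mutual_info (wiretap_law W C) (@message_rv A B n M) (@output_rv A B n M) <=
  n%:R * capacity W + 1 - (1 - e) * log2 L%:R.
Proof.
move=> hW M0 L0 hC he.
have hP := wiretap_law_pmf hW M0 L0 hC; have [P0 P1] := hP.
have M_gt0 : 0 < M%:R :> R by rewrite ltr0n.
have L_gt0 : 0 < L%:R :> R by rewrite ltr0n.
have hXZ x z := wiretap_input_output_law C x z hW.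
have hcap := mutual_info_dmc_le hW hP hXZ.
have heq := wiretap_equivocation_ge g hW M0 L0 hC.
have hE : M%:R^-1 * (\sum_u error_prob W (C u) (g u)) * ln L%:R <= e * ln L%:R.
  apply: ler_wpM2r; first by rewrite ln_ge0 // ler1n.
  rewrite ler_pdivrMl //; apply: le_trans (ler_sum _ (fun u _ => he u)) _.
  by rewrite sumr_const card_ord mulr_natl.
(* The chain rule I(U;Z) = I(X;Z) - I(X;Z|U). The subtracted term is H(X|U) - H(X|U,Z), with H(X|U)
   = [ln L%:R] as the input is uniform on [L] words. *)
have decomposition : mutual_info (wiretap_law W C) (@message_rv A B n M)
    (@output_rv A B n M) =
  mutual_info (wiretap_law W C) (fun w => w.1.2) (fun w => w.2) -
  ((\sum_w wiretap_law W C w *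
    ln (wiretap_law W C w /
        law (wiretap_law W C) (fun w => (w.1.1, w.2)) (w.1.1, w.2))) +
   ln L%:R) / ln 2.
  rewrite !mutual_infoE -mulrBl; congr (_ / _).
  have -> : ln L%:R = \sum_w wiretap_law W C w * ln L%:R.
    by rewrite -mulr_suml P1 mul1r.
  rewrite -big_split -sumrB /=.
  under [RHS]eq_bigr do rewrite -mulrDr -mulrBr.
  apply: eq_expect => // w Pw.
  have x0 := law_gt0 (fun w => w.1.2) P0 Pw.
  have z0 := law_gt0 (fun w => w.2) P0 Pw.
  have uz0 := law_gt0 (fun w => (w.1.1, w.2)) P0 Pw.
  rewrite /= in x0 z0 uz0.
  rewrite hXZ -mulf_div divff ?gt_eqF // mul1r (wiretap_message_law _ hW L0 hC).
  case: w Pw x0 z0 uz0 => -[u x] z /= Pw x0 z0 uz0.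
  have xC : x \in C u.
    by move: Pw; case: (x \in C u) => //; rewrite !(mul0r, mulr0) ltxx.
  have d0 : 0 < dmc W x z.
    by move: Pw; rewrite pmulr_rgt0 // xC hC mul1r mulr_gt0 ?invr_gt0.
  rewrite xC hC mul1r.
  rewrite /output_rv /message_rv.
  move: z0 uz0; set pz := law _ _ z; set puz := law _ _ (u, z) => z0 uz0.
  have Mi0 : 0 < M%:R^-1 :> R by rewrite invr_gt0.
  have Li0 : 0 < L%:R^-1 :> R by rewrite invr_gt0.
  have ML0 := mulr_gt0 Mi0 Li0.
  rewrite (ln_div uz0 (mulr_gt0 Mi0 z0)) (ln_div d0 z0).
  rewrite (ln_div (mulr_gt0 ML0 d0) uz0) (lnM Mi0 z0).
  by rewrite (lnM ML0 d0) (lnM Mi0 Li0) !lnV ?posrE //; lra.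
rewrite decomposition /log2.
have l2 : ln 2 > 0 :> R := ln2_gt0 R.
apply: le_trans (_ : _ <= n%:R * capacity W -
  (- ln 2 - e * ln L%:R + ln L%:R) / ln 2) _.
  rewrite lerB // ler_pM2r ?invr_gt0 // lerD2r; apply: le_trans heq.
  by rewrite lerB.
rewrite le_eqVlt; apply/orP; left; apply/eqP; field.
by rewrite gt_eqF.
Qed.

(** * Optimal decoders and passage to the limit *)

(** There are finitely many decoders. An optimal one depends on the code alone, whereas the decoders
    in [approaches_capacity] may depend on the whole sequence of codes. *)
Lemma exists_best_decoder (R : realType) (A B : finType) (W : A -> B -> R) n
    (C : {set word A n}) : (0 < #|C|)%N ->
  exists g : word B n -> word A n,
    forall g', error_prob W C g <= error_prob W C g'.
Proof.
case/card_gt0P => x0 _; pose err (f : {ffun word B n -> word A n}) := error_prob W C f.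
(* The constant decoder only witnesses that the finite type of decoders is inhabited. *)
have [f _ fmin] := @arg_minP _ R _ [ffun=> x0] predT err isT.
exists f => g'; have -> : error_prob W C g' = err (finfun g').
  apply: eq_bigr => x _; congr (_ * _).
  by apply: eq_bigl => z; rewrite ffunE.
exact: fmin.
Qed.

Lemma invr_natr_cvg0 (R : realType) (N : nat -> nat) :
  (forall i j, (i < j)%N -> (N i < N j)%N) ->
  (N k)%:R^-1 @[k --> \oo] --> (0 : R).
Proof.
move=> hN.
have leN k : (k <= N k)%N.
  by elim: k => // k IH; apply: leq_ltn_trans IH (hN _ _ (ltnSn k)).
apply/gtr0_cvgV0.
  near=> k; rewrite ltr0n; apply: leq_trans (leN k); near: k.
  exact: nbhs_infty_ge.
apply/cvgrnyP/cvgnyPge => a; near=> k; apply: leq_trans (leN k); near: k.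
exact: nbhs_infty_ge.
Unshelve. all: by end_near.
Qed.

Theorem theorem1 (R : realType) (A B : finType) (W : A -> B -> R)
    (hW : is_channel W)
    (N : nat -> nat) (hN : forall i j, (i < j)%N -> (N i < N j)%N)
    (M L : nat -> nat)
    (hM : forall k, (0 < M k)%N) (hL : forall k, (0 < L k)%N)
    (C : forall k, 'I_(M k) -> {set word A (N k)})
    (hC : forall k (u : 'I_(M k)), #|C k u| = L k)
    (hcap : forall u : (forall k, 'I_(M k)),
      approaches_capacity W (fun k => C k (u k))) :
  mutual_info (wiretap_law W (C k)) (@message_rv A B (N k) (M k))
    (@output_rv A B (N k) (M k)) / (N k)%:R @[k --> \oo] --> (0 : R).
Proof.
have C0 k u : (0 < #|C k u|)%N by rewrite hC.
pose g k u := sval (cid (exists_best_decoder W (C0 k u))).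
have gP k u : forall g', error_prob W (C k u) (g k u) <= error_prob W (C k u) g'.
  exact: svalP (cid (exists_best_decoder W (C0 k u))).
(* The worst messages form one admissible selection for [hcap], so a single vanishing error sequence
   bounds all messages. *)
pose worst k := [arg max_(u > Ordinal (hM k)) error_prob W (C k u) (g k u)]%O.
have worstP k u : error_prob W (C k u) (g k u) <=
    error_prob W (C k (worst k)) (g k (worst k)).
  by rewrite /worst; case: arg_maxP => // v _; apply.
have [hrate [d hd]] := hcap worst.
set e := (fun k => error_prob _ _ _) in hd.
have hI k : mutual_info (wiretap_law W (C k)) (@message_rv A B (N k) (M k))
    (@output_rv A B (N k) (M k)) <=
    (N k)%:R * capacity W + 1 - (1 - e k) * log2 (L k)%:R.
  (* Best decoder for [u], then best decoder for the worst code, then [d]: the errors increase up to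
     [e k]. *)
  apply: (wiretap_info_le (g := g k)) => // u.
  exact: le_trans (worstP k u) (gP _ _ _).
apply: (@squeeze_cvgr _ _ _ _ (fun=> 0) (fun k =>
    capacity W + (N k)%:R^-1 - (1 - e k) * rate R (C k (worst k)))).
(* [N 0] may be 0, so the division needs [k > 0]. *)
- near=> k.
  have N0 : 0 < (N k)%:R :> R.
    rewrite ltr0n; apply: leq_ltn_trans (leq0n (N 0)) (hN _ _ _).
    by near: k; apply: nbhs_infty_gt.
  rewrite divr_ge0 ?(ltW N0) ?mutual_info_ge0 //=; last first.
    exact: wiretap_law_pmf (hC k).
  (* All codes of index [k] have size [L k], so the rate of the worst code is the one in [hI]. *)
  rewrite /rate hC ler_pdivrMr //; apply: le_trans (hI k) _.
  rewrite le_eqVlt; apply/orP; left; apply/eqP; field.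
  by rewrite gt_eqF.
- exact: cvg_cst.
- have -> : (0 : R) = capacity W + 0 - (1 - 0) * capacity W by rewrite addr0 subr0 mul1r subrr.
  apply: cvgB; first by apply: cvgD; [exact: cvg_cst|exact: invr_natr_cvg0].
  by apply: cvgM hrate; apply: cvgB => //; exact: cvg_cst.
Unshelve. all: by end_near.
Qed.
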